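(* Let $j$, $r$, $n$, $m_0$ be positive integers with $j<r$. Suppose that $r(m-1)\leq g(m,j)\leq r(m-1)+n$ for every integer $m\geq m_0$ (with $m \geq 2$). Then $g(m,r)=(3r-j)(m-1)+1$ for every integer $m\geq \max\{m_0,n+1\}$ (with $m\ge 2$).
   Context: For positive integers $m$ and $r$, $g(m,r)$ denotes the least positive integer $N$ such that for every map $\Delta:\{1,2,\ldots,N\}\to\{1,2,\ldots,r\}$ there exist $2m$ integers $x_1<\cdots<x_m<y_1<\cdots<y_m$ in $\{1,\ldots,N\}$ with $\Delta(x_1)=\cdots=\Delta(x_m)$, $\Delta(y_1)=\cdots=\Delta(y_m)$, and $2(x_m-x_1)\leq y_m-x_1$. *)

(* Defs.v *)
From mathcomp Require Import all_boot zify.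
From mathcomp Require Import boolp.

Set Implicit Arguments.
Unset Strict Implicit.
Unset Printing Implicit Defensive.

(* Since D is only used on {1, ..., N}, a map {1, ..., N} -> {1, ..., r} is    *)
(* represented by any D : nat -> nat with these values on {1, ..., N}.         *)
Definition coloring (N r : nat) (D : nat -> nat) : Prop :=
  forall i, 1 <= i <= N -> 1 <= D i <= r.

(* x and y list x_1, ..., x_m and y_1, ..., y_m; the truncated subtractions    *)
(* are exact because x_1 <= x_m <= y_m.                                        *)
Definition solution (N m : nat) (D : nat -> nat) (x y : m.-tuple nat) : Prop :=
  [/\ all (fun i => 1 <= i <= N) (x ++ y),
      sorted ltn (x ++ y),
      constant (map D x),
      constant (map D y)
    & 2 * (last 0 x - head 0 x) <= last 0 y - head 0 x].

Definition forces (m r N : nat) : Prop :=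
  forall D, coloring N r D -> exists x y : m.-tuple nat, solution N D x y.

Lemma pigeonhole_interval (m r a : nat) (D : nat -> nat) :
  (forall i, a <= i < a + (r * m).+1 -> 1 <= D i <= r) ->
  exists x : m.-tuple nat,
    [/\ all (fun i => a <= i < a + (r * m).+1) x, sorted ltn x
      & constant (map D x)].
Proof.
move=> Dr; set s := iota a (r * m).+1.
have [c hc] : exists c, m <= count (fun i => D i == c) s.
  apply: contrapT => /forallNP hn.
  have : size s <= \sum_(c < r) m.
    rewrite -sum1_size big_seq.
    rewrite (eq_bigr (fun i => \sum_(c < r) (D i == c.+1 :> nat))) => [|i]; last first.
      rewrite mem_iota => /Dr /andP[D1 Dle].
      have lt : (D i).-1 < r by lia.
      rewrite (bigD1 (Ordinal lt)) //= prednK // eqxx big1 // => c.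
      by rewrite -val_eqE /= => /eqP hne; apply/eqP; rewrite eqb0; apply/eqP; lia.
    rewrite -big_seq exchange_big /=; apply: leq_sum => c _.
    have -> : \sum_(i <- s) (D i == c.+1 :> nat) = count (fun i => D i == c.+1) s.
      by rewrite -sum1_count [RHS]big_mkcond; apply: eq_bigr => i _; case: eqP.
    by have := hn c.+1 => /negP; rewrite -ltnNge => /ltnW.
  by rewrite size_iota sum_nat_const card_ord; lia.
set t := filter (fun i => D i == c) s.
have st : size (take m t) == m by rewrite size_takel // size_filter.
exists (Tuple st) => /=; split.
- apply/allP => i /mem_take; rewrite mem_filter mem_iota.
  by case/andP.
- apply: take_sorted; apply: sorted_filter; last exact: iota_ltn_sorted.
  exact: ltn_trans.
- have : all (pred1 c) (map D (take m t)).
    rewrite all_map; apply/allP => i /mem_take; rewrite mem_filter.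
    by case/andP.
  by case: (map D _) => //= u v /andP[/eqP -> ].
Qed.

Lemma forces_exists (m r : nat) : exists N, (0 < N) && `[< forces m r N >].
Proof.
exists (3 * (r * m).+1); apply/andP; split; first lia.
apply/asboolP => D hD.
have [|x [/allP xr xs xc]] := @pigeonhole_interval m r 1 D.
  by move=> i hi; apply: hD; lia.
have [|y [/allP yr ys yc]] := @pigeonhole_interval m r (2 * (r * m).+1).+1 D.
  by move=> i hi; apply: hD; lia.
exists x, y; split => //.
- apply/allP => i; rewrite mem_cat => /orP[/xr|/yr]; lia.
- rewrite (@sorted_pairwise _ ltn) ?pairwise_cat; last exact: ltn_trans.
  rewrite -!(@sorted_pairwise _ ltn); try exact: ltn_trans.
  rewrite xs ys !andbT; apply/allrelP => i k /xr hi /yr hk; lia.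
- case: m x y xr yr {xs xc ys yc hD} => [|m] x y xr yr.
    by rewrite (tuple0 x).
  have hx : last 0 x \in x by case/tupleP: x {xr} => u v; rewrite /= mem_last.
  have hy : last 0 y \in y by case/tupleP: y {yr} => u v; rewrite /= mem_last.
  by have := xr _ hx; have := yr _ hy; lia.
Qed.

Definition g (m r : nat) : nat := ex_minn (forces_exists m r).

(* Main.v *)
(* Write M = m - 1, and read a colouring of an initial segment as a word. A     *)
(* word without solution in which some letters are demoted to "holes" (not      *)
(* usable by x or y) is measured by its length and by its weight, the number of *)
(* colours times M plus the number of holes.                                    *)
(* Descent: a solution-free word in k colours, of weight W and length L > W,    *)
(* yields one of length W - 1 and weight at most 2 W + k M - L. Ascent: a       *)
(* solution-free word in J colours of length R M - 1 extends to one in R        *)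
(* colours of length (3 R - J) M.                                               *)
(* The ascent applied to g(m, j) >= r M is the lower bound. For the upper       *)
(* bound, a solution-free word in r colours of length (3 r - j) M + 1 descends  *)
(* to weight j M - 1 and length r M - 1. Its weight being below j M, it has at  *)
(* most j - 1 colours, so the next descent reaches weight (3 j - 1 - r) M - 1   *)
(* at length j M - 2. One more hole in front, new colours filling the holes,    *)
(* and an ascent give a solution-free word in j colours of length (r + 1) M,    *)
(* which contradicts g(m, j) <= r M + n <= (r + 1) M.                           *)

(* By [ltn_g_bad], [bad M k N] expresses that [N] lies below [g M.+1 k], so both bounds become
   statements about words. The descent [bad_descent] works because an x placed as early as possible
   makes every colour seen far to its right rare there, and demoting rare colours to holes does not
   raise the weight. Conversely [fill_holes] turns holes into colours too rare to serve x or y. The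
   ascent [bad_ascent] surrounds a solution-free word with blocks of new colours. In [bad_excess]
   the two descents are needed only when [2 * j <= r]; otherwise the explicit word of [bad_double]
   is already long enough. *)
Require Import Defs.
From mathcomp Require Import all_boot zify.
From mathcomp Require Import boolp.

Set Implicit Arguments.
Unset Strict Implicit.
Unset Printing Implicit Defensive.

(** * Words, palettes and holes *)

(* v spells the colours on [x_1, x_m] and rcons w d those on ]x_m, y_m], with  *)
(* m = M + 1; the last inequality is 2 (x_m - x_1) <= y_m - x_1.               *)
Definition wsol (M : nat) (Q s : seq nat) : Prop :=
  exists (u v w t : seq nat) (c d : nat),
    [/\ s = u ++ v ++ rcons w d ++ t, c \in Q, d \in Q,
        M < count_mem c v & M <= count_mem d w /\ size v <= (size w).+2].

Definition holes (Q s : seq nat) : nat := count (predC (mem Q)) s.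

Definition bad (M k N : nat) : Prop :=
  exists Q s : seq nat, [/\ uniq Q, size Q = k, size s = N, {subset s <= Q}
                & ~ wsol M Q s].

Lemma wsol_infix M (Q Q' a s b : seq nat) :
  {subset Q' <= Q} -> wsol M Q' s -> wsol M Q (a ++ s ++ b).
Proof.
move=> sQ [u [v [w [t [c [d [-> cQ dQ cv dw]]]]]]].
exists (a ++ u), v, w, (t ++ b), c, d; split; rewrite ?sQ //.
by rewrite -!catA.
Qed.

(** Cutting the padding off the front of [v] loses no palette letter and only relaxes the length
    condition. *)
Lemma wsol_pad M Q z k s : z \notin Q -> wsol M Q (nseq k z ++ s) -> wsol M Q s.
Proof.
move=> zQ; elim: k => //= k IH [[|a u] [v [w [t [c [d [/= E cQ dQ cv [dw vw]]]]]]]].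
  case: v E cv vw => [|a v] //= [<- E] cv vw; apply: IH.
  exists [::], v, w, t, c, d; split=> //; last by split=> //; lia.
  by move: cv; case: eqP => // zc; rewrite zc cQ in zQ.
by case: E => _ E; apply: IH; exists u, v, w, t, c, d.
Qed.

Lemma map_catP (f : nat -> nat) s a b : map f s = a ++ b ->
  exists a' b', [/\ s = a' ++ b', map f a' = a & map f b' = b].
Proof.
move=> E; exists (take (size a) s), (drop (size a) s).
by rewrite cat_take_drop map_take map_drop E take_size_cat ?drop_size_cat.
Qed.

Lemma count_mem_map (f : nat -> nat) c s :
  (forall x, (f x == c) = (x == c)) -> count_mem c (map f s) = count_mem c s.
Proof. by move=> fc; rewrite count_map; apply: eq_count => x /=. Qed.

(** Such an [f] fixes the palette and turns holes into holes, which no solution sees. *)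
Lemma wsol_map M Q f s : (forall c, c \in Q -> forall x, (f x == c) = (x == c)) ->
  wsol M Q (map f s) <-> wsol M Q s.
Proof.
move=> fQ; split=> [|] [u [v [w [t [c [d [E cQ dQ cv [dw vw]]]]]]]].
  have [u' [r [-> _ /map_catP]]] := map_catP E.
  move=> [v' [r' [-> Ev /map_catP]]] [w' [t' [-> Ew _]]].
  move: Ew; case/lastP: w' => [|w' d']; first by case: w {E dw vw}.
  rewrite map_rcons => /rcons_inj[Ew /eqP]; rewrite fQ // => /eqP Ed.
  exists u', v', w', t', c, d; split; rewrite ?Ed //.
    by rewrite -Ev (count_mem_map _ (fQ c cQ)) in cv.
  rewrite -Ew (count_mem_map _ (fQ d dQ)) in dw.
  by split=> //; rewrite -Ev -Ew !size_map in vw.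
exists (map f u), (map f v), (map f w), (map f t), c, d; split=> //.
- by rewrite E !map_cat map_rcons; have /eqP -> : f d == d by rewrite fQ.
- by rewrite (count_mem_map _ (fQ c cQ)).
by rewrite (count_mem_map _ (fQ d dQ)) !size_map.
Qed.

(** * Descent *)

Lemma count_mem_palette M (Q s : seq nat) :
  (forall q, q \in Q -> count_mem q s <= M) -> count (mem Q) s <= size Q * M.
Proof.
elim: Q => [|q Q IH] H; first by rewrite (@eq_count _ _ pred0) ?count_pred0.
have h1 := H q (mem_head _ _).
have h2 : count (mem Q) s <= size Q * M.
  by apply: IH => p pQ; apply: H; rewrite inE pQ orbT.
have := count_predUI (pred1 q) (mem Q) s.
rewrite (@eq_count _ (predU _ _) (mem (q :: Q))); last by move=> x; rewrite /= inE.
by move: h1 h2; rewrite /= mulSn; lia.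
Qed.

Lemma size_palette M (Q s : seq nat) :
  (forall q, q \in Q -> count_mem q s <= M) -> size s <= size Q * M + holes Q s.
Proof.
by move=> /count_mem_palette h; rewrite -(count_predC (mem Q) s) leq_add2r.
Qed.

(** The word is cut at the first letter that completes [M.+1] occurrences of some palette colour. *)
Lemma first_rich_prefix M (Q s : seq nat) q : q \in Q -> M < count_mem q s ->
  exists s1 c s2, [/\ s = s1 ++ c :: s2, c \in Q, count_mem c s1 = M
    & forall p, p \in Q -> count_mem p s1 <= M].
Proof.
elim/last_ind: s q => [|s x IH] q qQ //; rewrite -cats1 count_cat /= addn0 => hq.
case: (pselect (exists2 p, p \in Q & M < count_mem p s)) => [[p pQ hp]|H].
  have [s1 [c [s2 [-> h1 h2 h3]]]] := IH p pQ hp.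
  by exists s1, c, (s2 ++ [:: x]); rewrite -catA.
have {}H p : p \in Q -> count_mem p s <= M.
  by move=> pQ; rewrite leqNgt; apply/negP => hp; apply: H; exists p.
have := H q qQ; case: (eqVneq x q) hq => [->|_] /= hq h; last lia.
by exists s, q, [::]; split=> //; lia.
Qed.

Lemma exists_fresh (Q : seq nat) : exists z, z \notin Q.
Proof.
have le x : x \in Q -> x <= sumn Q.
  by elim: Q => //= a Q IH; rewrite inE => /orP[/eqP->|/IH]; lia.
by exists (sumn Q).+1; apply/negP => /le; rewrite ltnn.
Qed.

Lemma mem_split_last (x : nat) s : x \in s ->
  exists a b, s = a ++ x :: b /\ x \notin b.
Proof.
elim/last_ind: s => // s y IH; rewrite mem_rcons inE.
case: (eqVneq x y) => [<- _|ne /IH [a [b [-> hb]]]].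
  by exists s, [::]; rewrite cats1.
exists a, (rcons b y); split; first by rewrite rcons_cat.
by rewrite mem_rcons inE negb_or ne.
Qed.

(* The first M+1 equal letters of s force every palette letter occurring far  *)
(* behind them to occur at most M times behind them; those letters become     *)
(* holes, and what remains is the stretch between the two places.             *)
Lemma bad_descent M (Q s : seq nat) h : 0 < M -> uniq Q -> ~ wsol M Q s -> holes Q s <= h ->
    size Q * M + h < size s ->
  exists Q' s' : seq nat, [/\ uniq Q', ~ wsol M Q' s', size s' = (size Q * M + h).-1
    & size Q' * M + holes Q' s' + size s <= 3 * (size Q * M) + 2 * h].
Proof.
move=> M0 uQ nsol hh hs.
have [q qQ hq] : exists2 q, q \in Q & M < count_mem q s.
  apply: contrapT => H; suff: size s <= size Q * M + holes Q s by lia.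
  apply: size_palette => q qQ; rewrite leqNgt; apply/negP => hq.
  by apply: H; exists q.
have [s1 [c [s2 [Es cQ cs1 hs1]]]] := first_rich_prefix qQ hq.
have szs1 := size_palette hs1.
have s1_gt0 : 0 < size s1 by rewrite (leq_trans M0) // -cs1 count_size.
(* With [v = rcons s1 c], the length condition asks [size w] to be at least [(size s1).-1], which
   holds once y ends in [R]. *)
set J := take (size s1).-1 s2; set R := drop (size s1).-1 s2.
have s2E : s2 = J ++ R by rewrite cat_take_drop.
have late d : d \in Q -> d \in R -> count_mem d s2 <= M.
  move=> dQ dR; rewrite leqNgt; apply/negP => hd; apply: nsol.
  have szJ : size J = (size s1).-1.
    by rewrite size_takel //; move: dR; rewrite /R; case: leqP => // /ltnW/drop_oversize->.
  (* Ending y at the last [d] keeps all other occurrences of [d] behind [c] inside [w]. *)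
  have [r1 [r2 [RE dr2]]] := mem_split_last dR.
  exists [::], (rcons s1 c), (J ++ r1), r2, c, d; split=> //.
  - by rewrite Es s2E RE /= !cat_rcons -!catA.
  - by rewrite -cats1 count_cat cs1 /= eqxx; lia.
  split; last by rewrite size_rcons size_cat szJ; lia.
  move: hd; rewrite s2E RE !count_cat /= eqxx.
  by rewrite (count_memPn dr2); lia.
set Q' : seq nat := [seq d <- Q | d \notin R]; set K : seq nat := [seq d <- Q | d \in R].
have szQ : size Q' + size K = size Q.
  by rewrite !size_filter addnC -(count_predC (mem R) Q).
(* Demoting [K] removes [size K * M] from the colour part of the weight and creates at most as many
   holes in [s2]. *)
have hK : count (mem K) s2 <= size K * M.
  apply: count_mem_palette => d; rewrite mem_filter => /andP[dR dQ]; exact: late.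
have hQ' : holes Q' s2 <= holes Q s2 + count (mem K) s2.
  rewrite /holes; have := count_predUI (predC (mem Q)) (mem K) s2.
  suff : count (predC (mem Q')) s2 <= count (predU (predC (mem Q)) (mem K)) s2 by lia.
  apply: sub_count => x /=; rewrite !mem_filter.
  by case: (x \in R); case: (x \in Q).
have hR : holes Q' R = size R.
  rewrite /holes; apply/eqP; rewrite -all_count; apply/allP => x xR /=.
  by rewrite mem_filter xR.
have [z zQ] := exists_fresh Q'.
have szs : size s = size s1 + size J + size R + 1.
  by rewrite Es s2E !size_cat /= !size_cat /=; lia.
have szJ : size J <= (size s1).-1 by rewrite size_take; case: ltnP; lia.
have hsE : holes Q s = holes Q s1 + holes Q s2.
  by rewrite Es /holes count_cat /= cQ.
have hs2E : holes Q' s2 = holes Q' J + holes Q' R.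
  by rewrite {1}s2E /holes count_cat.
(* Holes in front bring the length to exactly one below the weight bound. *)
set pad := (size Q * M + h).-1 - size J.
exists Q', (nseq pad z ++ J); split.
- exact: filter_uniq.
- move/(wsol_pad zQ) => /(@wsol_infix _ Q Q' (rcons s1 c) _ R) H.
  apply: nsol; rewrite Es s2E; move: H; rewrite cat_rcons; apply.
  by move=> x; rewrite mem_filter => /andP[].
- by rewrite size_cat size_nseq /pad; lia.
have hp : holes Q' (nseq pad z ++ J) = pad + holes Q' J.
  by rewrite /holes count_cat count_nseq /= zQ mul1n.
have szQM : size Q' * M + size K * M = size Q * M by rewrite -mulnDl szQ.
by rewrite hp /pad; lia.
Qed.

(** * Filling holes with new colours *)

Lemma take_count (P : pred nat) s k : k <= count P s ->
  exists a b, s = a ++ b /\ count P a = k.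
Proof.
elim: s k => [|x s IH] [|k] //=; try by exists [::], [::].
  by move=> _; exists [::], (x :: s).
case Px : (P x) => /= h.
  have [a [b [-> ha]]] := IH k h.
  by exists (x :: a), b; rewrite /= Px ha.
have [a [b [-> ha]]] := IH k.+1 h.
by exists (x :: a), b; rewrite /= Px ha.
Qed.

(** A colour occurring at most [M] times can colour neither x nor y, so each fresh colour absorbs
    [M] holes. *)
Lemma fill_holes M k (Q s : seq nat) : uniq Q -> ~ wsol M Q s -> holes Q s <= k * M ->
  bad M (size Q + k) (size s).
Proof.
elim: k Q s => [|k IH] Q s uQ nsol hh.
  exists Q, s; split; rewrite ?addn0 // => x xs; apply/negPn/negP => xQ.
  have : has (predC (mem Q)) s by apply/hasP; exists x.
  by rewrite has_count; move: hh; rewrite /holes; lia.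
have [z] := exists_fresh (Q ++ s); rewrite mem_cat negb_or => /andP[zQ zs].
have [a [b [Es ha]]] := @take_count (predC (mem Q)) s (minn M (holes Q s)) (geq_minr _ _).
pose f x := if x \in Q then x else z.
pose s' := map f a ++ b.
have cz : count_mem z s' <= M.
  rewrite count_cat count_map (@eq_in_count _ _ (predC (mem Q))) => [|x xa].
    rewrite ha (_ : count_mem z b = 0) ?addn0 ?geq_minl //.
    by apply/count_memPn; apply: contra zs; rewrite Es mem_cat => ->; rewrite orbT.
  rewrite /= /f; case: ifP => //= xQ; last by rewrite eqxx.
  by apply/eqP => xz; move: zQ; rewrite -xz xQ.
have nsol' : ~ wsol M (z :: Q) s'.
  move=> [u [v [w [t [c [d [E cQ dQ cv [dw vw]]]]]]]]; apply: nsol.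
  have {}cQ : c \in Q.
    move: cQ; rewrite inE => /orP[/eqP cE|//].
    by move: cz; rewrite E !count_cat -cE; lia.
  have {}dQ : d \in Q.
    move: dQ; rewrite inE => /orP[/eqP dE|//].
    by move: cz dw; rewrite -dE E !count_cat -cats1 !count_cat /= eqxx; lia.
  have fP e : e \in Q -> forall x, (f x == e) = (x == e).
    move=> eQ x; rewrite /f; case: ifP => // xQ.
    by apply/eqP/eqP => E'; [move: zQ; rewrite E' eQ | rewrite E' eQ in xQ].
  apply/(wsol_map _ _ fP).
  (* [f] sends every hole to [z], which erases the difference between [s] and [s']. *)
  have -> : map f s = map f s'.
    rewrite Es !map_cat -map_comp; congr (_ ++ _); apply: eq_map => x /=.
    by rewrite /f; case: (boolP (x \in Q)) => xQ; rewrite ?xQ ?(negbTE zQ).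
  by apply/(wsol_map _ _ fP); exists u, v, w, t, c, d.
have hs' : holes (z :: Q) s' <= k * M.
  have h1 : holes (z :: Q) (map f a) = 0.
    rewrite /holes count_map; apply/eqP; rewrite -leqn0 leqNgt -has_count.
    by apply/negP => /hasP[x _ /=]; rewrite /f inE; case: ifP => xQ; rewrite ?xQ ?eqxx ?orbT.
  have h2 : holes (z :: Q) b <= holes Q b.
    by apply: sub_count => x /=; rewrite inE; case: (x \in Q); rewrite ?orbT.
  have h3 : holes Q s = minn M (holes Q s) + holes Q b.
    by rewrite {1}Es /holes count_cat ha.
  rewrite /holes count_cat -/(holes _ _) -/(holes _ b) h1; lia.
have -> : size s = size s' by rewrite Es !size_cat size_map.
by rewrite -addSnnS; apply: (IH (z :: Q)) => //=; rewrite zQ.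
Qed.

(** * Ascent *)

Definition blocks (M : nat) (Q : seq nat) : seq nat := flatten [seq nseq M c | c <- Q].

Lemma size_blocks M Q : size (blocks M Q) = size Q * M.
Proof. by elim: Q => //= q Q IH; rewrite size_cat size_nseq IH mulSn. Qed.

Lemma count_blocks M (Q : seq nat) c :
  uniq Q -> count_mem c (blocks M Q) = (c \in Q) * M.
Proof.
elim: Q => //= q Q IH /andP[qQ uQ].
rewrite count_cat count_nseq IH //= inE (eq_sym c); case: eqP => [<-|_] //=.
by rewrite (negbTE qQ); lia.
Qed.

Lemma mem_blocks M Q : {subset blocks M Q <= Q}.
Proof. by move=> x /flattenP[_ /mapP[c cQ ->]] /nseqP[-> _]. Qed.

(* Any multiset b can be listed so that each letter comes up at least as fast *)
(* as it does in s, until the supply of b is exhausted.                       *)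
Lemma greedy_listing (s b : seq nat) : exists w : seq nat, perm_eq w b /\
  forall q c, minn (count_mem c b) (count_mem c (take q s)) <= count_mem c (take q w).
Proof.
elim: s b => [|a s IH] b.
  by exists b; split=> // q c; rewrite /= minn0.
case: (boolP (a \in b)) => ab.
  have [w [wb H]] := IH (rem a b).
  have pb := perm_to_rem ab.
  exists (a :: w); split; first by rewrite (perm_trans _ (_ : perm_eq (a :: rem a b) b)) ?perm_cons // perm_sym.
  move=> [|q] c /=; first by rewrite minn0.
  have := H q c; have /permP/(_ (pred1 c)) -> /= := pb; lia.
have [w [wb H]] := IH b; exists w; split=> // -[|q] c /=; first by rewrite minn0.
have h : count_mem c (take q w) <= count_mem c (take q.+1 w).
  by rewrite -(cat_take_drop q (take q.+1 w)) take_takel // count_cat leq_addr.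
case: (eqVneq a c) => [<-|_] /=; first by rewrite (count_memPn ab) min0n.
exact: leq_trans (H q c) h.
Qed.

Lemma count_take_le (P : pred nat) n s : count P (take n s) <= count P s.
Proof. by rewrite -{2}(cat_take_drop n s) count_cat leq_addr. Qed.

Lemma count_drop_le (P : pred nat) n s : count P (drop n s) <= count P s.
Proof. by rewrite -{2}(cat_take_drop n s) count_cat leq_addl. Qed.

(** Each copy of the blocks holds [M] letters of every colour: x must reach into the second copy,
    where too few letters remain for y. *)
Lemma bad_double M k : bad M k (2 * (k * M)).
Proof.
pose Q := iota 0 k; have uQ : uniq Q by apply: iota_uniq.
have cQ c : count_mem c (blocks M Q) <= M by rewrite count_blocks //; case: (_ \in _); lia.
exists Q, (blocks M Q ++ blocks M Q); split=> //.
- by rewrite size_iota.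
- by rewrite size_cat size_blocks size_iota; lia.
- by move=> x; rewrite mem_cat orbb => /mem_blocks.
move=> [u [v [w [t [c [d [E _ _ cv [dw vw]]]]]]]].
have E1 : u ++ v = take (size (u ++ v)) (blocks M Q ++ blocks M Q).
  by rewrite E catA take_size_cat.
have E2 : rcons w d ++ t = drop (size (u ++ v)) (blocks M Q ++ blocks M Q).
  by rewrite E catA drop_size_cat.
case: (ltnP (size (u ++ v)) (size (blocks M Q))) => h.
  move: E1; rewrite takel_cat 1?ltnW // => /(congr1 (count_mem c)); rewrite count_cat.
  move: cv (cQ c) (count_take_le (pred1 c) (size (u ++ v)) (blocks M Q)) => /=; lia.
move: E2; rewrite drop_cat ltnNge h /= => /(congr1 (count_mem d)).
rewrite -cats1 !count_cat /= eqxx => E2.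
move: E2 dw (cQ d).
have := count_drop_le (pred1 d) (size (u ++ v) - size (blocks M Q)) (blocks M Q).
by rewrite /=; lia.
Qed.

Lemma fresh_palette (Q : seq nat) k : uniq Q ->
  exists Z : seq nat, uniq (Q ++ Z) /\ size Z = k.
Proof.
move=> uQ; elim: k => [|k [Z [uZ sZ]]]; first by exists [::]; rewrite cats0.
have [z zQ] := exists_fresh (Q ++ Z); exists (rcons Z z).
by rewrite -rcons_cat rcons_uniq zQ uZ size_rcons sZ.
Qed.

Lemma count_takeS (P : pred nat) p q s : q <= p -> count P (take q s) <= count P (take p s).
Proof. by move=> qp; rewrite -(take_takel s qp) count_take_le. Qed.

(* The bad word t is preceded by a copy of its colours listed greedily and by *)
(* the new colours, and followed by the new colours; a new colour d0 opening  *)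
(* and closing the prefix brings its length to R * M + 1. A monochromatic x   *)
(* starting in the prefix is then too long for any y ending within t.         *)
Lemma bad_ascent M J R : 0 < M -> J < R -> bad M J (R * M - 1) ->
  bad M R ((3 * R - J) * M).
Proof.
move=> M0 JR [Q [t [uQ sQ st tQ nsol]]].
have [[|d0 Z] [uQZ sZ]] := fresh_palette (R - J) uQ; first by move: sZ => /=; lia.
have [w [wb wt]] := greedy_listing t (blocks M Q).
have cw c : count_mem c w = (c \in Q) * M.
  by have /permP/(_ (pred1 c)) -> := wb; rewrite count_blocks.
have wQ : {subset w <= Q} by move=> x; rewrite (perm_mem wb) => /mem_blocks.
have sw : size w = J * M by rewrite (perm_size wb) size_blocks sQ.
set zz := blocks M (d0 :: Z).
pose mid := blocks M Z ++ nseq M.-1 d0.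
pose pre := d0 :: w ++ mid.
have szZ : (size Z).+1 = R - J by [].
have RMJ : (size Z).+1 * M + J * M = R * M by rewrite szZ -mulnDl subnK // ltnW.
have szZM : (size Z).+1 * M = size Z * M + M by rewrite mulSn addnC.
have smid : (size mid).+1 = (size Z).+1 * M.
  by rewrite size_cat size_blocks size_nseq; lia.
have spre : size pre = R * M by rewrite /= size_cat sw; lia.
have szz : size zz = (size Z).+1 * M by rewrite size_blocks.
move: (uQZ); rewrite cat_uniq /= => /and3P[_ /norP[d0Q nZQ] /andP[d0Z uZ]].
have ZQ c : c \in Z -> c \notin Q.
  by move=> cZ; apply: contra nZQ => cQ; apply/hasP; exists c.
have cmid c : count_mem c mid = (c \in Z) * M + (d0 == c) * M.-1.
  by rewrite count_cat count_blocks // count_nseq.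
have cpre c : count_mem c pre <= M.
  rewrite /= count_cat cw cmid; case: (eqVneq d0 c) => [<-|_] /=.
    by rewrite (negbTE d0Q) (negbTE d0Z) /=; clear - M0; lia.
  by case: (boolP (c \in Z)) => [/ZQ/negbTE->|_]; case: (c \in Q) => /=; clear; lia.
have czz c : count_mem c zz <= M.
  by rewrite count_blocks /= ?d0Z //; case: (_ \in _); clear; lia.
have ct c : c \notin Q -> count_mem c t = 0.
  by move=> cQ; apply/count_memPn; apply: contra cQ => /tQ.
set s := rcons pre d0 ++ t ++ zz.
exists (Q ++ d0 :: Z), s; split=> //.
- by rewrite size_cat sQ /= szZ; lia.
- rewrite size_cat size_rcons spre size_cat st szz mulnBl -mulnA.
  have : 0 < R * M by rewrite muln_gt0 M0 andbT; lia.
  lia.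
- have zzQ x : x \in blocks M Z ++ nseq M.-1 d0 -> x \in Q ++ d0 :: Z.
    rewrite !mem_cat inE => /orP[/mem_blocks->|/nseqP[-> _]]; rewrite ?eqxx !orbT //.
  move=> x xs; have : [|| x == d0, x \in w, x \in mid, x \in t | x \in zz].
    move: xs; rewrite mem_cat mem_rcons inE mem_cat [x \in pre]inE mem_cat.
    by case: eqP; case: (x \in w); case: (x \in mid).
  case/or4P=> [/eqP->|/wQ xQ|/zzQ//|/orP[/tQ xQ|/mem_blocks xZ]];
    by rewrite mem_cat ?xQ ?xZ ?mem_head ?orbT.
move=> [u [v [y [r [c [d [E cQZ dQZ cv [dy vy]]]]]]]].
set a := size (u ++ v).
have E1 : u ++ v = take a s by rewrite E catA take_size_cat.
have E2 : rcons y d ++ r = drop a s by rewrite E catA drop_size_cat.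
(* No colour occurs more than [M] times in [pre], so [v] contains the closing [d0]. *)
have a_gt : R * M < a.
  rewrite ltnNge; apply/negP => ale.
  move: E1; rewrite /s -cats1 -catA takel_cat ?spre // => /(congr1 (count_mem c)).
  rewrite count_cat; move: cv (cpre c) (count_take_le (pred1 c) a pre) => /=; clear; lia.
set q := a - (R * M).+1.
have {}E2 : rcons y d ++ r = drop q (t ++ zz).
  by rewrite E2 /s drop_cat size_rcons spre ltnNge a_gt.
have dQ : d \in Q.
  apply/negPn/negP => dQ; move: E2 => /(congr1 (count_mem d)).
  rewrite -cats1 !count_cat /= eqxx.
  have := count_drop_le (pred1 d) q (t ++ zz); rewrite count_cat ct //.
  by move: dy (czz d) => /=; clear; lia.
have dzz : d \notin zz.
  apply/negP => /mem_blocks; rewrite inE => /orP[/eqP dE|/ZQ]; last by rewrite dQ.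
  by rewrite -dE dQ in d0Q.
have qy : q + (size y).+1 <= size t.
  rewrite leqNgt; apply/negP => h; case/negP: dzz.
  have : d \in drop (q + size y) (t ++ zz).
    by rewrite addnC -drop_drop -E2 cat_rcons drop_size_cat // mem_head.
  have {h} : size t <= q + size y by rewrite addnS ltnS in h.
  by rewrite drop_cat ltnNge => -> /=; exact: mem_drop.
have av : a = size u + size v by rewrite /a size_cat.
have aE : a = (R * M).+1 + q by rewrite subnKC.
have small : size u + 2 * size v <= 2 * (R * M) + 1 by clear - av vy qy st aE; lia.
have qt : q < size t by clear - qy; lia.
set t1 := take q t.
have {}E1 : u ++ v = rcons pre d0 ++ t1.
  rewrite E1 /s take_cat size_rcons spre ltnNge a_gt /= -/q.
  by rewrite takel_cat // ltnW.
have tE : t = t1 ++ rcons y d ++ drop (size y).+1 (drop q t).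
  rewrite -{1}(cat_take_drop q t); congr (_ ++ _).
  rewrite -{1}(cat_take_drop (size y).+1 (drop q t)); congr (_ ++ _).
  move: E2; rewrite drop_cat qt; move/(congr1 (take (size y).+1)).
  by rewrite take_size_cat ?size_rcons // takel_cat // size_drop; clear - qy; lia.
have solt u' v' : t1 = u' ++ v' -> c \in Q -> M < count_mem c v' ->
    size v' <= size v -> False.
  move=> t1E cQ cv' v'v; apply: nsol.
  exists u', v', y, (drop (size y).+1 (drop q t)), c, d; split=> //.
    by rewrite {1}tE t1E -catA.
  by split=> //; apply: leq_trans vy.
have t1_size : size t1 = q by rewrite size_takel // ltnW.
(* An empty [u] would make [v] longer than [R * M], against [small]; hence the opening [d0] lies
   outside [v], and each new colour occurs at most [M] times in [v]. *)
case uE: u E1 av small => [|e u'] E1 av small; first by move: av small => /=; clear - a_gt; lia.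
move: E1; rewrite /pre /= => -[_ E1].
set p := size u'.
have vE : v = drop p (w ++ rcons mid d0 ++ t1).
  by rewrite catA -rcons_cat -E1 drop_size_cat.
have cQ : c \in Q.
  apply/negPn/negP => cQ.
  have := count_drop_le (pred1 c) p (w ++ rcons mid d0 ++ t1); rewrite -vE.
  rewrite !count_cat cw (negbTE cQ) -cats1 count_cat cmid /= addn0.
  have : count_mem c t1 = 0 by have := count_take_le (pred1 c) q t; rewrite ct //= leqn0 => /eqP.
  move: cv; case: (eqVneq d0 c) => [<-|_]; rewrite ?(negbTE d0Z) /=; first by clear - M0; lia.
  by case: (c \in Z) => /=; clear; lia.
case: (leqP (size (w ++ rcons mid d0)) p) => pl.
  apply: (solt (take (p - size (w ++ rcons mid d0)) t1) v) => //.
  by rewrite vE catA drop_cat ltnNge pl /= cat_take_drop.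
have vE' : v = drop p (w ++ rcons mid d0) ++ t1 by rewrite vE catA drop_cat pl.
have cm : count_mem c (rcons mid d0) = 0.
  apply/count_memPn; apply/negP; rewrite mem_rcons inE mem_cat => /or3P[/eqP cE|/mem_blocks/ZQ|/nseqP[cE _]].
  - by rewrite -cE cQ in d0Q.
  - by rewrite cQ.
  - by rewrite -cE cQ in d0Q.
have cvle : count_mem c v <= count_mem c (drop p w) + count_mem c t1.
  rewrite vE' count_cat leq_add2r drop_cat; case: ltnP => _; first by rewrite count_cat cm addn0.
  by apply: leq_trans (count_drop_le _ _ _) _; rewrite cm.
have cwp : count_mem c (take p w) + count_mem c (drop p w) = M.
  by rewrite -count_cat cat_take_drop cw cQ mul1n.
have [c0|cpos] := posnP (count_mem c (drop p w)).
  apply: (solt [::] t1) => //; last by rewrite vE' size_cat leq_addl.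
  by move: cv cvle; rewrite c0; apply: leq_trans.
(* [v] misses [p] letters of [w] and uses the [q] letters of [t1]. If [q <= p], greediness puts at
   least as many [c] among the missed letters as in [t1], leaving at most [M] in [v]; if [p < q], x
   starts too early for [small]. *)
have := wt q c; rewrite count_blocks // cQ mul1n -/t1.
case: (leqP q p) => qp.
  have := @count_takeS (pred1 c) p q w qp.
  by move: cv cvle cwp cpos => /=; clear; lia.
by move: small av; rewrite /= -/p; clear - aE qp; lia.
Qed.

(** * Words versus colourings *)

Lemma path_ltn_bounds a s i : path ltn a s -> i \in a :: s -> a <= i <= last a s.
Proof.
elim: s a i => [|b s IH] a i /=; first by rewrite inE => _ /eqP->; rewrite leqnn.
move=> /andP[ab bs]; rewrite inE => /orP[/eqP->|ibs].
  by have := IH b b bs (mem_head _ _); lia.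
by have := IH b i bs ibs; lia.
Qed.

Lemma count_constant (E : nat -> nat) c x s : {subset x <= s} -> uniq x ->
  constant (map E x) -> c \in x -> size x <= count_mem (E c) (map E s).
Proof.
move=> sub ux /(constantP 0)[e Ee] cx; rewrite count_map.
have ex k : k \in x -> E k = e.
  by move=> /(map_f E); rewrite Ee => /nseqP[].
rewrite -size_filter; apply: (uniq_leq_size ux) => k kx.
by rewrite mem_filter sub // andbT /= !ex.
Qed.

Lemma wsol_of_solution M N (Q : seq nat) (E : nat -> nat) (x y : M.+1.-tuple nat) :
  (forall i, 1 <= i <= N -> E i \in Q) -> solution N E x y ->
  wsol M Q (map E (iota 1 N)).
Proof.
move=> EQ; case: x y => [[|a x] //= sx] [[|b y] //= sy] [/allP xyN xys cx cy].
rewrite /=; set p := last a x; set z := last b y => diam.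
have [xs ps] : path ltn a x /\ path ltn p (b :: y) by move: xys; rewrite /= cat_path => /andP[].
have [pb ys] : p < b /\ path ltn b y by move: ps => /= /andP[].
have xP i : i \in a :: x -> a <= i <= p by exact: path_ltn_bounds.
have yP i : i \in b :: y -> b <= i <= z by exact: path_ltn_bounds.
have px : p \in a :: x by exact: mem_last.
have zy : z \in b :: y by exact: mem_last.
have aN : 1 <= a <= N by apply: xyN; rewrite mem_head.
have zN : 1 <= z <= N by apply: xyN; rewrite mem_cat zy orbT.
have ap := xP p px; have bz := yP z zy.
have uniq_path e l : path ltn e l -> uniq (e :: l).
  by move=> h; apply: (sorted_uniq ltn_trans ltnn).
exists (map E (iota 1 a.-1)), (map E (iota a (p.+1 - a))),
  (map E (iota p.+1 (z - p.+1))), (map E (iota z.+1 (N - z))), (E a), (E z).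
split; [|exact: EQ|exact: EQ| |].
- rewrite -map_rcons -!map_cat; congr (map E _).
  have -> : rcons (iota p.+1 (z - p.+1)) z = iota p.+1 (z - p).
    have -> : z - p = (z - p.+1) + 1 by lia.
    by rewrite -cats1 iotaD /=; congr (_ ++ [:: _]); lia.
  have -> : N = a.-1 + ((p.+1 - a) + ((z - p) + (N - z))) by lia.
  rewrite !iotaD; congr (_ ++ _).
  have -> : 1 + a.-1 = a by lia.
  congr (_ ++ _).
  have -> : a + (p.+1 - a) = p.+1 by lia.
  congr (_ ++ _); congr iota; lia.
- rewrite -(eqP sx); apply: (count_constant _ _ cx); rewrite ?mem_head ?uniq_path //.
  by move=> i /xP; rewrite mem_iota; lia.
split; last by rewrite !size_map !size_iota; lia.
have : size (b :: y) <= count_mem (E z) (map E (iota p.+1 (z - p.+1) ++ [:: z])).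
  apply: (count_constant _ _ cy) => //; last by apply: uniq_path.
  by move=> i /yP; rewrite mem_cat mem_iota inE; case: eqP => //; lia.
by rewrite map_cat count_cat /= eqxx addn0 addn1 (eqP sy).
Qed.

Lemma iota_catP k n (u r : seq nat) : iota k n = u ++ r ->
  u = iota k (size u) /\ r = iota (k + size u) (n - size u).
Proof.
move=> E; have sz : n = size u + size r by rewrite -size_cat -E size_iota.
move: E; rewrite {1}sz iotaD => /eqP; rewrite eqseq_cat ?size_iota //.
by case/andP=> /eqP <- /eqP <-; rewrite !size_iota sz addKn.
Qed.

Lemma constant_filter (E : nat -> nat) c s : (forall i, i \in s -> E i = c) ->
  constant (map E s).
Proof.
move=> H; apply: (@all_pred1_constant _ c); rewrite all_map.
by apply/allP => i /H /= ->.
Qed.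

(** [v] need not begin or end with [c]: moving x_1 right or x_m left only helps the inequality. *)
Lemma solution_of_wsol M N (Q : seq nat) (E : nat -> nat) :
  wsol M Q (map E (iota 1 N)) -> exists x y : M.+1.-tuple nat, solution N E x y.
Proof.
move=> [u' [v' [w' [t' [c [d [EE _ _ cv [dw vw]]]]]]]].
have [u [r [Er _ /map_catP]]] := map_catP EE.
move=> [v [r' [E' Ev /map_catP]]] [wz [t [Er' Ewz _]]].
case/lastP: wz => [|w z] in Er' Ewz *; first by case: w' {EE dw vw} Ewz.
rewrite map_rcons in Ewz; have [Ew Ed] := rcons_inj Ewz.
rewrite -{}Ew -{}Ev !size_map !count_map in cv dw vw.
rewrite {}Er' in E'; rewrite {}E' in Er.
pose fx := [seq i <- v | E i == c]; pose fy := [seq i <- w | E i == d].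
have sx : size (take M.+1 fx) == M.+1 by rewrite size_takel // size_filter.
have sy : size (rcons (take M fy) z) == M.+1 by rewrite size_rcons size_takel ?size_filter.
have subx : subseq (take M.+1 fx) v by exact: subseq_trans (take_subseq _ _) (filter_subseq _ _).
have suby : subseq (rcons (take M fy) z) (rcons w z).
  by rewrite -!cats1 cat_subseq //; exact: subseq_trans (take_subseq _ _) (filter_subseq _ _).
have [_ Evr] := iota_catP Er.
have [Ev Ewr] := iota_catP (esym Evr).
have := Ewr; rewrite cat_rcons => Ewr'.
have [Ew Ezr] := iota_catP (esym Ewr').
have Ez : z = 1 + size u + size v + size w by case: (N - _ - _ - _) Ezr => //= k [].
have sub : subseq (take M.+1 fx ++ rcons (take M fy) z) (iota 1 N).
  rewrite Er -[X in subseq X _]cat0s; apply: cat_subseq; first exact: sub0seq.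
  apply: cat_subseq => //; apply: subseq_trans suby _; exact: prefix_subseq.
exists (Tuple sx), (Tuple sy); split=> /=.
- by apply/allP => i /(mem_subseq sub); rewrite mem_iota; lia.
- by apply: (subseq_sorted ltn_trans sub); exact: iota_ltn_sorted.
- by apply: (@constant_filter _ c) => i /mem_take; rewrite mem_filter => /andP[/eqP].
- apply: (@constant_filter _ d) => i; rewrite mem_rcons inE => /orP[/eqP->//|/mem_take].
  by rewrite mem_filter => /andP[/eqP].
rewrite last_rcons.
have inv i : i \in take M.+1 fx -> size u < i <= size u + size v.
  by move=> /(mem_subseq subx); rewrite {1}Ev mem_iota; lia.
have hx : head 0 (take M.+1 fx) \in take M.+1 fx by case: (take _ _) sx => // *; rewrite mem_head.
have lx : last 0 (take M.+1 fx) \in take M.+1 fx.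
  by case: (take _ _) sx => // i l _; exact: mem_last.
by have := inv _ hx; have := inv _ lx; clear - Ez vw; lia.
Qed.

Lemma wsol_nil M Q : ~ wsol M Q [::].
Proof. by move=> [[|? ?] [[|? ?] [[|? ?] [? [? [? []]]]]]]. Qed.

Lemma bad_prefix M k N N' : N' <= N -> bad M k N -> bad M k N'.
Proof.
move=> le [Q [s [uQ sQ sN sub nsol]]]; exists Q, (take N' s); split=> //.
- by rewrite size_takel // sN.
- by move=> i /mem_take /sub.
move=> h; apply: nsol; rewrite -(cat_take_drop N' s) -[take _ _]cat0s -catA.
by apply: wsol_infix h.
Qed.

Lemma ltn_g_bad M k N : N < g M.+1 k <-> bad M k N.
Proof.
rewrite /g; case: ex_minnP => G /andP[G0 /asboolP GF] Gmin; split.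
  case: N => [_|N NG].
    exists (iota 1 k), [::]; split; rewrite ?iota_uniq ?size_iota //.
    exact: wsol_nil.
  have /existsNP[D /not_implyP[DN nsol]] : ~ forces M.+1 k N.+1.
    by move=> F; have := Gmin N.+1; rewrite asboolT // => /(_ isT); lia.
  exists (iota 1 k), (map D (iota 1 N.+1)); split.
  - exact: iota_uniq.
  - by rewrite size_iota.
  - by rewrite size_map size_iota.
  - move=> c /mapP[i]; rewrite mem_iota => iN ->.
    by have := DN i; rewrite mem_iota; lia.
  - by move=> /solution_of_wsol.
move=> b; rewrite ltnNge; apply/negP => GN.
have {b} [Q [s [uQ sQ sG sub nsol]]] := bad_prefix GN b.
pose E i := nth 0 s i.-1.
have EQ i : 1 <= i <= G -> E i \in Q.
  by move=> iG; apply: sub; rewrite mem_nth // sG; lia.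
(* Numbering colours by their position in [Q], plus one, turns the palette into {1, ..., k}. *)
have [|x [y [xyN xys cx cy diam]]] := GF (fun i => (index (E i) Q).+1).
  by move=> i /EQ; rewrite -index_mem sQ.
have cst z : {subset z <= x ++ y} -> constant (map (fun i => (index (E i) Q).+1) z) ->
    constant (map E z).
  move=> zxy /(constantP 0)[e Ee]; apply: (@constant_filter _ (nth 0 Q e.-1)) => i iz.
  have := map_f (fun i => (index (E i) Q).+1) iz; rewrite Ee => /nseqP[<- _] /=.
  by rewrite nth_index // EQ //; apply: (allP xyN); apply: zxy.
apply: nsol; have -> : s = map E (iota 1 G).
  rewrite -{1}[s](mkseq_nth 0) sG /mkseq (iotaDl 1 0) -map_comp.
  by apply: eq_map => i; rewrite /E /=.
apply: (wsol_of_solution EQ (x := x) (y := y)); split=> //.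
  by apply: cst => // i ix; rewrite mem_cat ix.
by apply: cst => // i iy; rewrite mem_cat iy orbT.
Qed.

(** * Upper bound and conclusion *)

Lemma bad_excess M j r : 0 < M -> j < r -> bad M r ((3 * r - j) * M + 1) ->
  bad M j ((r + 1) * M).
Proof.
move=> M0 jr [Q [s [uQ sQ ss sub nsol]]].
case: (ltnP r (2 * j)) => rj.
  apply: bad_prefix (bad_double M j); rewrite mulnA leq_mul2r; lia.
have h0 : holes Q s <= 0.
  by rewrite leqn0 -[_ == 0]negbK -lt0n -has_count; apply/negP => /hasP[x /sub xQ /=]; rewrite xQ.
have jrM : j * M + M <= r * M by rewrite -mulSnr leq_mul2r jr orbT.
have rjM : 2 * (j * M) <= r * M by rewrite mulnA leq_mul2r rj orbT.
have ssE : size s + j * M = 3 * (r * M) + 1 by rewrite ss mulnBl -mulnA; lia.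
have [|Q1 [s1 [uQ1 nsol1 ss1 le1]]] := bad_descent M0 uQ nsol h0; first by rewrite sQ; lia.
rewrite sQ addn0 in ss1 le1.
have {}le1 : size Q1 * M + holes Q1 s1 < j * M by clear - le1 ssE; lia.
have Q1j : size Q1 < j.
  by rewrite -(ltn_pmul2r M0); apply: leq_ltn_trans le1; rewrite leq_addr.
have Q1jM : size Q1 * M + M <= j * M by rewrite -mulSnr leq_mul2r Q1j orbT.
(* [h] overstates the holes so that the weight bound is exactly [(j * M).-1], which fixes the length
   after the second descent. *)
set h := (j * M).-1 - size Q1 * M.
have hE : size Q1 * M + h = (j * M).-1 by rewrite /h; clear - le1; lia.
have h1 : holes Q1 s1 <= h by rewrite /h; clear - le1; lia.
have [|Q2 [s2 [uQ2 nsol2 ss2 le2]]] := bad_descent M0 uQ1 nsol1 h1.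
  by rewrite hE ss1; clear - jrM Q1jM M0; lia.
rewrite hE in ss2; rewrite ss1 in le2.
have {}le2 : size Q2 * M + holes Q2 s2 + 1 + r * M + M <= 3 * (j * M).
  by clear - le2 hE Q1jM jrM M0; lia.
(* This makes [3 * j - i] equal to [r + 1], the length wanted from the ascent; [le2] ensures that
   the subtraction is exact. *)
set i := 3 * j - 1 - r.
have iE : i + 1 + r = 3 * j.
  have rlt : r * M < 3 * j * M by rewrite -mulnA; clear - le2; lia.
  by rewrite ltn_pmul2r // in rlt; rewrite /i; clear - rlt; lia.
have iME : i * M + M + r * M = 3 * (j * M) by rewrite mulnA -iE !mulnDl mul1n.
have Q2i : size Q2 <= i.
  by rewrite -(leq_pmul2r M0); clear - le2 iME; lia.
have [z zQ2] := exists_fresh Q2.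
have b : bad M i (j * M - 1).
  have -> : j * M - 1 = size (z :: s2) by rewrite /= ss2; clear - le2 rjM M0; lia.
  rewrite -(subnKC Q2i); apply: fill_holes => //.
    by move=> /(@wsol_pad _ _ z 1 s2 zQ2).
  rewrite mulnBl /holes /= zQ2 -/(holes Q2 s2); clear - le2 iME; lia.
have -> : r + 1 = 3 * j - i by clear - iE; lia.
by apply: bad_ascent => //; clear - iE rj; lia.
Qed.

Theorem theorem4p3 (j r n m0 : nat)
  (hj : 0 < j) (hr : 0 < r) (hn : 0 < n) (hm0 : 0 < m0) (hjr : j < r)
  (hg : forall m, 2 <= m -> m0 <= m ->
    r * (m - 1) <= g m j <= r * (m - 1) + n) :
  forall m, 2 <= m -> maxn m0 (n + 1) <= m ->
    g m r = (3 * r - j) * (m - 1) + 1.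
Proof.
move=> [|M] // M0; rewrite geq_max => /andP[m0M nM].
have := hg _ M0 m0M; rewrite subn1 /= => /andP[lb ub].
rewrite ltnS in M0; rewrite addn1 ltnS in nM.
apply/eqP; rewrite eqn_leq; apply/andP; split; last first.
  rewrite addn1; apply/ltn_g_bad; apply: bad_ascent => //.
  apply/ltn_g_bad; apply: leq_trans lb; rewrite subn1 ltn_predL muln_gt0 hr; lia.
rewrite leqNgt; apply/negP => /ltn_g_bad /(bad_excess M0 hjr) /ltn_g_bad.
by rewrite mulnDl mul1n; clear - ub nM; lia.
Qed.
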